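(* Let $p(x),q(x),v(x)$ be non-zero polynomials and $w(x)$ a polynomial, and let $g(x)=\sum_{n\ge0}g_nx^n$ be a power series which is the expansion of $$g(x)=\frac{q(x)}{w(x)+v(x)\sqrt{p(x)}}.$$ Define the polynomials $$R=2pvq(v^2p-w^2)=\sum_{j=0}^{\deg R}R_jx^j,$$ $$Q=-4pvqww'+2pq(pv^2+w^2)v'+vq(pv^2+w^2)p'-2pv(pv^2-w^2)q'=\sum_{j=0}^{\deg Q}Q_jx^j,$$ $$H=-q^2(2pvw'-2wpv'-wvp'),$$ and set $R_j=0$ and $Q_j=0$ whenever $j<0$ or $j$ exceeds the respective degree. Then $$\sum_{j=0}^{\deg R}\bigl[(n-j)R_j+Q_{j-1}\bigr]g_{n-j}=0\qquad\text{for all integers } n \text{ with } n-\deg R>\deg H .$$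
   Context: Polynomials have complex coefficients; primes denote $d/dx$. The degree of the zero polynomial is taken to be $0$. The statement that the power series $g(x)=\sum_{n\ge0}g_nx^n$ is the expansion of the given expression means: $g$ has a positive radius of convergence, and on some non-empty open connected subset of its disc of convergence $g$ equals the given expression for some choice of analytic branch of the square root (the expression being well defined there, i.e. with non-vanishing denominator). *)

(* Defs.v *)
(* The complex numbers are R[i] for R : realType. *)
From HB Require Import structures.
From mathcomp Require Import all_boot all_order all_algebra.
From mathcomp Require Import complex.
From mathcomp Require Import all_classical all_reals all_analysis.

Set Implicit Arguments.
Unset Strict Implicit.
Unset Printing Implicit Defensive.

Import Order.TTheory GRing.Theory Num.Theory.
Import numFieldNormedType.Exports.

Local Open Scope classical_set_scope.
Local Open Scope ring_scope.
Local Open Scope complex_scope.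

(* R[i] as a normed space over itself; in particular [derivable f z 1] below is
   complex differentiability. *)
HB.instance Definition _ (R : realType) := NormedModule.copy R[i] R[i]^o.

(* deg 0 = 0 *)
Definition deg (K : nzRingType) (P : {poly K}) : nat := (size P).-1.

Definition extz (K : nmodType) (a : nat -> K) (k : int) : K :=
  if k is Posz m then a m else 0.

Section PowerSeries.
Variable R : realType.
Implicit Types (g : nat -> R[i]) (z : R[i]) (U : set R[i]).

Definition cpseries g z : nat -> R[i] := series (fun n => g n * z ^+ n).

Definition cvg_radius g : \bar R :=
  ereal_sup [set (ComplexField.Normc.normc z)%:E
            | z in [set z | cvgn (cpseries g z)]].

Definition cvg_disc g : set R[i] :=
  [set z | ((ComplexField.Normc.normc z)%:E < cvg_radius g)%E].

Definition analytic_on U (f : R[i] -> R[i]) : Prop :=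
  forall z, U z -> derivable f z 1.

Definition is_sqrt_branch (p : {poly R[i]}) U (s : R[i] -> R[i]) : Prop :=
  analytic_on U s /\ forall z, U z -> s z ^+ 2 = p.[z].

Definition is_expansion (p q v w : {poly R[i]}) g : Prop :=
  (0 < cvg_radius g)%E /\
  exists (U : set R[i]) (s : R[i] -> R[i]),
    [/\ [/\ open U, connected U, U !=set0 & U `<=` cvg_disc g],
        is_sqrt_branch p U s
      & forall z, U z ->
          w.[z] + v.[z] * s z != 0 /\
          cpseries g z @ \oo --> q.[z] / (w.[z] + v.[z] * s z)].

End PowerSeries.

Section Polynomials.
Variable K : comNzRingType.
Implicit Types p q v w : {poly K}.

Definition polR p q v w : {poly K} := 2 * p * v * q * (v ^+ 2 * p - w ^+ 2).

Definition polQ p q v w : {poly K} :=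
  - 4 * p * v * q * w * w^`()
  + 2 * p * q * (p * v ^+ 2 + w ^+ 2) * v^`()
  + v * q * (p * v ^+ 2 + w ^+ 2) * p^`()
  - 2 * p * v * (p * v ^+ 2 - w ^+ 2) * q^`().

Definition polH p q v w : {poly K} :=
  - q ^+ 2 * (2 * p * v * w^`() - 2 * w * p * v^`() - w * v * p^`()).

End Polynomials.

(* Main.v *)
(* Put N = v^2 p - w^2. Squaring q - w g = v s g, where s^2 = p, gives the
   quadratic equation N g^2 + 2 q w g - q^2 = 0, which holds on an open set and
   hence for power series by the identity theorem. So S = N g + q w satisfies
   S^2 = T with T = q^2 v^2 p a polynomial, whence 2 T S' = T' S; dividing by
   q v yields R g' + Q g = H, and the recurrence is its coefficient of x^(n-1).
   Working modulo a high power of x, this last part takes place in {poly R[i]}.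
   The identity theorem is proved without re-expansion, by a Hardy space
   argument on the coefficients: if f(z) = 0 with |z| < 1, then
   f = (x - z) h, and (1 - z^* x) h has the l^2 norm of f, while its constant
   coefficient is that of f divided by - z. An f vanishing at k points of a disc
   of radius r < 1 thus satisfies |f(0)| <= r^k ||f||. *)
Require Import Defs.
From mathcomp Require Import all_boot all_order all_algebra.
From mathcomp Require Import complex.
From mathcomp Require Import all_classical all_reals all_analysis.
From mathcomp Require Import ring lra zify.

Set Implicit Arguments.
Unset Strict Implicit.
Unset Printing Implicit Defensive.

Import Order.TTheory GRing.Theory Num.Theory.
Import numFieldNormedType.Exports.
Import ComplexField.Normc.

Local Open Scope classical_set_scope.
Local Open Scope ring_scope.
Local Open Scope complex_scope.

(** * The complex modulus, null sequences and geometric decay *)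

Section ComplexNorm.
Variable R : realType.
Implicit Types (z : R[i]) (u v : nat -> R[i]).

Lemma normc_ge0 z : 0 <= normc z.
Proof. by case: z => a b; apply: sqrtr_ge0. Qed.

Lemma normc_zero : normc (0 : R[i]) = 0.
Proof. exact: normc0. Qed.

Lemma normcX z n : normc (z ^+ n) = normc z ^+ n.
Proof. by elim: n => [|n IH]; rewrite ?expr0 ?normc1// !exprS normcM IH. Qed.

Lemma normc_sum I (r : seq I) (P : pred I) (F : I -> R[i]) :
  normc (\sum_(i <- r | P i) F i) <= \sum_(i <- r | P i) normc (F i).
Proof.
elim/big_ind2: _ => // [|x a y b xa yb]; first by rewrite normc0.
exact: le_trans (le_normcD _ _) (lerD xa yb).
Qed.

Lemma normcB_le x y : normc (x - y) <= normc x + normc y :> R.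
Proof. by rewrite -[normc y]normcN le_normcD. Qed.

Lemma cvg_normc u l :
  u @ \oo --> l <-> (fun n => normc (u n - l)) @ \oo --> (0 : R).
Proof.
split=> [/cvgrPdist_lt h|/cvgrPdist_lt h].
  apply/cvgrPdist_lt => e e0.
  have e0' : 0 < e%:C by rewrite ltcR.
  apply: filterS (h _ e0') => n hn.
  by rewrite sub0r normrN ger0_norm ?normc_ge0// -ltcR -opprB normcN.
apply/cvgrPdist_lt => e e0.
have eR : e = (complex.Re e)%:C.
  by case: e e0 => a b /=; rewrite ltcE/= => /andP[/eqP-> _].
move: e0; rewrite eR ltcR => e0.
apply: filterS (h _ e0) => n hn.
move: hn; rewrite sub0r normrN ger0_norm ?normc_ge0// -normcN opprB -ltcR.
exact.
Qed.

Lemma cvg0_normc u : u @ \oo --> 0 <-> (fun n => normc (u n)) @ \oo --> (0 : R).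
Proof. by rewrite cvg_normc; under eq_fun do rewrite subr0. Qed.

Lemma cvg0_le u (b : nat -> R) :
  (forall n, normc (u n) <= b n) -> b @ \oo --> 0 -> u @ \oo --> 0.
Proof.
move=> ub b0; apply/cvg0_normc; apply: squeeze_cvgr (cvg_cst 0) b0.
by apply: nearW => n; rewrite normc_ge0 ub.
Qed.

Lemma sum_geometric_le (x : R) m n : 0 <= x < 1 ->
  \sum_(m <= k < n) x ^+ k <= x ^+ m / (1 - x).
Proof.
move=> /andP[x0 x1]; have x1' : 0 < 1 - x by rewrite subr_gt0.
case: (leqP m n) => [mn|/ltnW nm]; last first.
  by rewrite big_geq// divr_ge0 ?exprn_ge0// ltW.
rewrite ler_pdivlMr//; apply: (@le_trans _ _ (x ^+ m - x ^+ n)); last first.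
  by rewrite lerBlDr lerDl exprn_ge0.
rewrite mulr_suml (@telescope_sumr_eq _ m n (fun k => - x ^+ k))//.
  by rewrite opprK addrC.
by move=> k _; rewrite exprSr; ring.
Qed.

Definition geo_decay (t : R) (a : nat -> R[i]) :=
  exists C, forall n, normc (a n) <= C * t ^+ n.

Lemma geo_decay_cvg0 t a : 0 <= t < 1 -> geo_decay t a -> a @ \oo --> 0.
Proof.
move=> /andP[t0 t1] [C aC]; apply: cvg0_le aC _.
by apply: cvg_geometric; rewrite ger0_norm.
Qed.

End ComplexNorm.

(** * Zeros of power series in the unit disc, divided out by Blaschke factors *)

Section IdentityTheorem.
Variable R : realType.
Implicit Types (z : R[i]) (a f : nat -> R[i]).

(** Coefficients of x f(x), so that [delay f n - z * f n] are those of (x - z) f(x). *)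
Definition delay f n : R[i] := if n is m.+1 then f m else 0.

Lemma geo_decay_delay t f : 0 < t -> geo_decay t f -> geo_decay t (delay f).
Proof.
move=> t0 [C fC]; have C0 : 0 <= C.
  by have := le_trans (normc_ge0 _) (fC 0%N); rewrite expr0 mulr1.
exists (C / t) => -[|n]; last by rewrite exprS mulrA divfK ?gt_eqF//; exact: fC.
by rewrite [delay _ _]/= normc_zero expr0 mulr1 divr_ge0// ltW.
Qed.

Lemma geo_decay_lin t f h (c : R[i]) :
  geo_decay t f -> geo_decay t h -> geo_decay t (fun n => f n - c * h n).
Proof.
move=> [C fC] [D hD]; exists (C + normc c * D) => n.
apply: le_trans (normcB_le _ _) _; rewrite mulrDl lerD//.
by rewrite normcM -mulrA ler_wpM2l// normc_ge0.
Qed.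

(** The quotient by x - z has coefficients - z^-(n+1) times the partial sums at z. The whole sum
    being 0, such a partial sum is minus a tail, of order (t|z|)^(n+1), so the decay rate t survives
    the division. *)
Lemma div_root t a z : 0 <= t < 1 -> z != 0 -> normc z <= 1 ->
  geo_decay t a -> cpseries a z @ \oo --> 0 ->
  exists2 f, geo_decay t f & forall n, a n = delay f n - z * f n.
Proof.
move=> /andP[t0 t1] z0 z1 [C aC] az.
pose f n := - z^-1 ^+ n.+1 * cpseries a z n.+1.
have nz0 : 0 < normc z.
  by rewrite lt_neqAle normc_ge0 andbT eq_sym; apply: contra_neq z0 => /eq0_normc.
exists f; last first.
  have zV n : z ^+ n * z^-1 ^+ n = 1 by rewrite -exprMn mulfV// expr1n.
  case=> [|n] /=; rewrite /f /cpseries /series /=.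
    by rewrite big_nat1 sub0r expr0 mulr1 expr1; field.
  rewrite (big_nat_recr n.+1)//=.
  set P := (\sum_(_ <= _ < _) _); rewrite !mulrDr opprD.
  have -> : z * (- z^-1 ^+ n.+2 * P) = - z^-1 ^+ n.+1 * P.
    by rewrite (exprS _ n.+1); field.
  rewrite addrA subrr sub0r -{1}[a n.+1]mulr1 -(zV n.+1) exprSr.
  by rewrite (exprS z^-1 n.+1); field.
pose x := t * normc z.
have x0 : 0 <= x by rewrite mulr_ge0// normc_ge0.
have x1 : x < 1 by rewrite /x (le_lt_trans _ t1)// ler_piMr.
have C0 : 0 <= C.
  by have := le_trans (normc_ge0 _) (aC 0%N); rewrite expr0 mulr1.
(* The tail is cut at an index where the partial sum is below e in modulus; what remains is
   majorized by a geometric sum. *)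
have part n : normc (cpseries a z n) <= C * (x ^+ n / (1 - x)).
  apply/ler_addgt0Pr => e e0.
  move/cvg0_normc/cvgrPdist_lt: az => /(_ _ e0) [N _ /(_ (maxn N n))] /=.
  rewrite leq_maxl sub0r normrN ger0_norm ?normc_ge0// => /(_ isT) he.
  have -> : cpseries a z n = cpseries a z (maxn N n)
      - \sum_(n <= k < maxn N n) a k * z ^+ k.
    by rewrite /cpseries /series/= (@big_cat_nat _ _ _ n 0 (maxn N n))//= ?leq_maxr// addrK.
  apply: le_trans (normcB_le _ _) _; rewrite addrC lerD// ?(ltW he)//.
  apply: le_trans (normc_sum _ _ _) _.
  apply: le_trans (_ : \sum_(n <= k < maxn N n) C * x ^+ k <= _).
    apply: ler_sum => k _; rewrite normcM normcX exprMn mulrA.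
    by rewrite ler_wpM2r// exprn_ge0// normc_ge0.
  by rewrite -mulr_sumr ler_wpM2l// sum_geometric_le// x0 x1.
exists (C * t / (1 - x)) => n.
rewrite /f normcM normcN normcX normcV.
apply: le_trans (ler_wpM2l _ (part n.+1)) _; first by rewrite exprn_ge0// invr_ge0 ltW.
rewrite /x exprMn !mulrA exprVn.
rewrite le_eqVlt; apply/orP; left; apply/eqP.
rewrite exprS [t^+ _]exprS. field.
by rewrite subr_eq0 eq_sym lt_eqF//= !gt_eqF// exprn_gt0.
Qed.

Lemma sqr_normcE z : normc z ^+ 2 = complex.Re z ^+ 2 + complex.Im z ^+ 2.
Proof. by case: z => x y /=; rewrite sqr_sqrtr// addr_ge0// sqr_ge0. Qed.

(** Both squared moduli have the same cross term, so only the diagonal terms differ. *)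
Lemma blaschke_isometry (c x y : R[i]) :
  normc (y - c^* * x) ^+ 2
  = normc (x - c * y) ^+ 2 + (1 - normc c ^+ 2) * (normc y ^+ 2 - normc x ^+ 2).
Proof. by rewrite !sqr_normcE; case: c x y => [? ?] [? ?] [? ?] /=; ring. Qed.

(** The corrections telescope because [delay f n.+1] is [f n]. When f tends to 0 the boundary term
    disappears in the limit. *)
Lemma blaschke_sum (c : R[i]) f N :
  \sum_(n < N) normc (f n - c^* * delay f n) ^+ 2
  = \sum_(n < N) normc (delay f n - c * f n) ^+ 2
    + (1 - normc c ^+ 2) * normc (delay f N) ^+ 2.
Proof.
elim: N => [|N IH].
  by rewrite !big_ord0 [delay _ _]/= normc_zero expr0n/= mulr0 addr0.
by rewrite !big_ord_recr/= IH blaschke_isometry; ring.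
Qed.

Lemma cpseries_delay z f N :
  \sum_(0 <= n < N) delay f n * z ^+ n
  = z * \sum_(0 <= n < N) f n * z ^+ n - delay f N * z ^+ N.
Proof.
elim: N => [|N IH]; first by rewrite !big_geq//= mul0r mulr0 subr0.
by rewrite !big_nat_recr//= IH exprS; ring.
Qed.

Lemma normc_pow_cvg0 t f z : 0 <= t < 1 -> geo_decay t f -> normc z <= 1 ->
  (fun n => f n * z ^+ n) @ \oo --> 0.
Proof.
move=> t01 ft z1; apply: (@cvg0_le _ _ (fun n => normc (f n))).
  by move=> n; rewrite normcM normcX ler_piMr ?normc_ge0// exprn_ile1// normc_ge0.
by apply/cvg0_normc; apply: geo_decay_cvg0 ft.
Qed.

(** Division by the Blaschke factor of z: with a = (x - z) f, the series b = (1 - z^* x) f keeps the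
    l^2 bound and the other zeros. *)
Lemma blaschke_step t B a z : 0 < t < 1 -> z != 0 -> normc z < 1 ->
  geo_decay t a -> (forall N, \sum_(n < N) normc (a n) ^+ 2 <= B) ->
  cpseries a z @ \oo --> 0 ->
  exists b, [/\ geo_decay t b, forall N, \sum_(n < N) normc (b n) ^+ 2 <= B,
    a 0%N = - z * b 0%N
    & forall y, y != z -> normc y <= 1 ->
      cpseries a y @ \oo --> 0 -> cpseries b y @ \oo --> 0].
Proof.
move=> /andP[t0 t1] z0 z1 at_ aB az.
have t01 : 0 <= t < 1 by rewrite ltW.
have [f ft aE] := div_root t01 z0 (ltW z1) at_ az.
have dft := geo_decay_delay t0 ft.
exists (fun n => f n - z^* * delay f n); split.
- exact: geo_decay_lin.
- move=> N; apply/ler_addgt0Pr => e e0.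
  (* The sum is prolonged to an index where the boundary term is below e; the bound by 1 makes the
     squared modulus at most the modulus. *)
  have /cvg0_normc/cvgrPdist_lt/(_ (Order.min e 1)) := geo_decay_cvg0 t01 dft.
  rewrite lt_min e0 ltr01 => /(_ isT) [M _ /(_ (maxn M N))] /=.
  rewrite leq_maxl sub0r normrN ger0_norm ?normc_ge0// => /(_ isT).
  rewrite lt_min => /andP[dM dM1].
  apply: (@le_trans _ _ (\sum_(n < maxn M N) normc (f n - z^* * delay f n) ^+ 2)).
    rewrite -!(big_mkord xpredT (fun n => normc (f n - z^* * delay f n) ^+ 2)).
    rewrite [leRHS](@big_cat_nat _ _ _ N)//= ?leq_maxr// lerDl sumr_ge0// => i _.
    exact: sqr_ge0.
  rewrite blaschke_sum lerD//.
    by under eq_bigr do rewrite -aE.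
  have z2 : 0 <= normc z ^+ 2 by apply: sqr_ge0.
  have z21 : normc z ^+ 2 <= 1 by rewrite exprn_ile1 ?normc_ge0// ltW.
  apply: le_trans (ltW dM).
  apply: le_trans (_ : normc (delay f (maxn M N)) ^+ 2 <= _).
    by rewrite ler_piMl ?sqr_ge0// lerBlDr lerDl.
  by rewrite expr2 ler_piMl ?normc_ge0// ltW.
- by rewrite aE /= sub0r mulr0 subr0 mulNr.
- move=> y yz y1 ay.
  have fy0 := normc_pow_cvg0 t01 dft y1.
  (* Up to a vanishing boundary term a(y) = (y - z) f(y), so f(y) = 0. *)
  have aEy N : cpseries a y N = (y - z) * cpseries f y N - delay f N * y ^+ N.
    rewrite mulrBl -addrAC -cpseries_delay /cpseries /series/= mulr_sumr -sumrB.
    by apply: eq_bigr => n _; rewrite aE; ring.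
  have fy : cpseries f y @ \oo --> 0.
    have -> : cpseries f y = fun N =>
        (y - z)^-1 * (cpseries a y N + delay f N * y ^+ N).
      by apply/funext => N; rewrite aEy subrK mulKf// subr_eq0.
    rewrite -[X in _ --> X](mulr0 (y - z)^-1) -[X in _ * X](addr0 0).
    by apply: cvgMr; apply: cvgD.
  have -> : cpseries (fun n => f n - z^* * delay f n) y = fun N =>
      (1 - z^* * y) * cpseries f y N + z^* * (delay f N * y ^+ N).
    apply/funext => N.
    have -> : delay f N * y ^+ N = y * cpseries f y N - cpseries (delay f) y N.
      by rewrite [cpseries (delay f) y N]cpseries_delay opprB addrC subrK.
    have -> : cpseries (fun n => f n - z^* * delay f n) y N =
        cpseries f y N - z^* * cpseries (delay f) y N.
      rewrite /cpseries /series/= mulr_sumr -sumrB.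
      by apply: eq_bigr => n _; ring.
    ring.
  rewrite -[X in _ --> X](addr0 0) -[X in _ --> X + _](mulr0 (1 - z^* * y)).
  rewrite -[X in _ --> _ + X](mulr0 z^*).
  by apply: cvgD; apply: cvgMr.
Qed.

(** Each zero z divided out gains a factor |z| <= r, since a_0 = - z b_0, while B is unchanged. *)
Lemma zeros_bound t B r (s : seq R[i]) a : 0 < t < 1 -> r < 1 -> uniq s ->
  {in s, forall z, [/\ z != 0, normc z <= r & cpseries a z @ \oo --> 0]} ->
  geo_decay t a -> (forall N, \sum_(n < N) normc (a n) ^+ 2 <= B) ->
  normc (a 0%N) ^+ 2 <= r ^+ (2 * size s) * B.
Proof.
move=> t01 r1; elim: s a => [|z s IH] a /=.
  by move=> _ _ _ /(_ 1%N); rewrite big_ord1 muln0 expr0 mul1r.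
move=> /andP[zs us] sa at_ aB.
have [z0 zr az] := sa z (mem_head _ _).
have r0 : 0 <= r := le_trans (normc_ge0 _) zr.
have [b [bt bB -> bs]] := blaschke_step t01 z0 (le_lt_trans zr r1) at_ aB az.
have /IH/(_ bt bB) : {in s, forall y,
    [/\ y != 0, normc y <= r & cpseries b y @ \oo --> 0]}.
  move=> y ys; have [y0 yr ay] : [/\ y != 0, normc y <= r & cpseries a y @ \oo --> 0].
    by apply: sa; rewrite inE ys orbT.
  split=> //; apply: bs => //; last by rewrite ltW// (le_lt_trans yr).
  by apply: contraNneq zs => <-.
move=> /(_ us) bb; rewrite normcM normcN exprMn mulnS exprD -mulrA.
by rewrite ler_pM ?sqr_ge0// lerXn2r// nnegrE normc_ge0.
Qed.

(** The bound r^(2k) B for every k forces the constant coefficient to be 0. Once the coefficients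
    below n vanish, division by x^n keeps the nonzero zeros, and the argument applies to a_n. *)
Lemma infinite_zeros t r a (y : nat -> R[i]) : 0 < t < 1 -> r < 1 ->
  injective y -> (forall k, y k != 0) -> (forall k, normc (y k) <= r) ->
  (forall k, cpseries a (y k) @ \oo --> 0) -> geo_decay t a ->
  forall n, a n = 0.
Proof.
move=> t01 r1 yI y0 yr; have /andP[t0 t1] := t01.
have r0 : 0 <= r := le_trans (normc_ge0 _) (yr 0%N).
suff H b : (forall k, cpseries b (y k) @ \oo --> 0) -> geo_decay t b -> b 0%N = 0.
  move=> ay at_ n; elim/ltn_ind: n => n IH.
  rewrite -[n]add0n; apply: (H (fun k => a (k + n)%N)); last first.
    case: at_ => C aC; exists (C * t ^+ n) => k.
    by rewrite -mulrA -exprD addnC.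
  move=> k.
  have -> : cpseries (fun k => a (k + n)%N) (y k) =
      fun N => (y k ^+ n)^-1 * cpseries a (y k) (N + n)%N.
    apply/funext => N; apply/(canRL (mulKf _)); first by rewrite expf_neq0.
    rewrite /cpseries /series/= (@big_cat_nat _ _ _ n 0 (N + n))//= ?leq_addl//.
    rewrite [X in _ = X + _]big_nat_cond [X in _ = X + _]big1 ?add0r; last first.
      by move=> i /andP[/andP[_ iN] _]; rewrite IH// mul0r.
    rewrite -[X in _ = \sum_(X <= _ < _) _]add0n big_addn addnK mulr_sumr.
    by apply: eq_bigr => i _; rewrite exprD; ring.
  rewrite -[X in _ --> X](mulr0 (y k ^+ n)^-1); apply: cvgMr.
  by have := ay k; rewrite -(cvg_shiftn n).
move=> by0 bt; have [C bC] := bt.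
have C0 : 0 <= C.
  by have := le_trans (normc_ge0 _) (bC 0%N); rewrite expr0 mulr1.
pose B := C ^+ 2 / (1 - t ^+ 2).
have t21 : 0 <= t ^+ 2 < 1 by rewrite sqr_ge0 expr_lt1// ltW.
have bB N : \sum_(n < N) normc (b n) ^+ 2 <= B.
  apply: (@le_trans _ _ (C ^+ 2 * \sum_(0 <= n < N) (t ^+ 2) ^+ n)).
    rewrite big_mkord mulr_sumr ler_sum// => n _.
    rewrite -exprM mulnC exprM -exprMn.
    by rewrite lerXn2r ?nnegrE ?normc_ge0// mulr_ge0// exprn_ge0// ltW.
  rewrite ler_wpM2l ?sqr_ge0//.
  by have := sum_geometric_le 0 N t21; rewrite expr0 mul1r.
have b0 k : normc (b 0%N) ^+ 2 <= B * (r ^+ 2) ^+ k.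
  have /= := @zeros_bound t B r (map y (iota 0 k)) b t01 r1.
  rewrite size_map size_iota exprM mulrC; apply=> //.
    by rewrite map_inj_uniq// iota_uniq.
  by move=> z /mapP[j _ ->].
have r2 : `|r ^+ 2| < 1 by rewrite ger0_norm ?sqr_ge0// expr_lt1.
apply/eqP; apply: contraT => b00.
have v0 : 0 < normc (b 0%N) ^+ 2.
  rewrite exprn_gt0// lt_def normc_ge0 andbT.
  by apply: contra_neq b00 => /eq0_normc.
have /cvgrPdist_lt/(_ _ v0)[N _ /(_ N (leqnn N))] := @cvg_geometric R B _ r2.
rewrite /= sub0r normrN ger0_norm; first by rewrite ltNge b0.
by rewrite (le_trans (ltW v0))// b0.
Qed.

End IdentityTheorem.

(** * Cauchy products and the growth of coefficients *)

Section CauchyProduct.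
Variable R : realType.
Implicit Types (z : R[i]) (a b : nat -> R[i]) (P Q : {poly R[i]}).

Definition conv a b n := \sum_(i < n.+1) a i * b (n - i)%N.

Lemma conv_coef P Q n : conv (nth 0 P) (nth 0 Q) n = (P * Q)`_n.
Proof. by rewrite coefM. Qed.

Lemma conv_pow z a b n :
  conv (fun k => a k * z ^+ k) (fun k => b k * z ^+ k) n = conv a b n * z ^+ n.
Proof.
rewrite /conv mulr_suml; apply: eq_bigr => i _.
have -> : z ^+ n = z ^+ i * z ^+ (n - i) by rewrite -exprD subnKC// leq_ord.
ring.
Qed.

Lemma eq_conv n a b a' b' : (forall k, (k <= n)%N -> a k = a' k) ->
  (forall k, (k <= n)%N -> b k = b' k) -> conv a b n = conv a' b' n.
Proof.
move=> aa bb; apply: eq_bigr => i _.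
by rewrite aa ?bb ?leq_subr// -ltnS.
Qed.

(** Each of the n + 1 terms is at most C D t^n. Their number is absorbed by the larger ratio u, as
    t^n <= u^n (t/u)^i for i <= n. *)
Lemma conv_bound C D t u a b n : 0 <= t < u ->
  (forall k, normc (a k) <= C * t ^+ k) ->
  (forall k, normc (b k) <= D * t ^+ k) ->
  normc (conv a b n) <= C * D / (1 - t / u) * u ^+ n.
Proof.
move=> /andP[t0 tu] aC bD; have u0 : 0 < u by rewrite (le_lt_trans t0).
have C0 : 0 <= C.
  by have := le_trans (normc_ge0 _) (aC 0%N); rewrite expr0 mulr1.
have D0 : 0 <= D.
  by have := le_trans (normc_ge0 _) (bD 0%N); rewrite expr0 mulr1.
have x01 : 0 <= t / u < 1.
  by apply/andP; split; [rewrite divr_ge0// ltW|rewrite ltr_pdivrMr// mul1r].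
apply: le_trans (normc_sum _ _ _) _.
apply: (@le_trans _ _ (\sum_(0 <= i < n.+1) C * D * u ^+ n * (t / u) ^+ i)).
  rewrite big_mkord ler_sum// => i _; rewrite normcM.
  apply: le_trans (ler_pM (normc_ge0 _) (normc_ge0 _) (aC _) (bD _)) _.
  rewrite mulrACA -exprD (subnKC (leq_ord i)) -!mulrA ler_wpM2l// ler_wpM2l//.
  apply: (@le_trans _ _ (u ^+ n * (t / u) ^+ n)).
    by rewrite -exprMn mulrC divfK// gt_eqF.
  rewrite ler_wpM2l ?exprn_ge0 ?(ltW u0)//.
  by case/andP: x01 => x0 x1; apply: ler_wiXn2l; rewrite ?(ltW x1)// leq_ord.
rewrite -mulr_sumr [leRHS]mulrAC ler_wpM2l ?mulr_ge0 ?exprn_ge0 ?(ltW u0)//.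
by have := sum_geometric_le 0 n.+1 x01; rewrite expr0 mul1r.
Qed.

(** With A and B the truncations below degree n, the difference is the sum of the coefficients of A
    B from n to 2n - 1, since those below n agree with the Cauchy product. It is O(u^n) for u
    between t and 1. *)
Lemma cvg_conv t a b : 0 <= t < 1 -> geo_decay t a -> geo_decay t b ->
  (fun n => series a n * series b n - series (conv a b) n) @ \oo --> 0.
Proof.
move=> /andP[t0 t1] [C aC] [D bD].
pose u := (t + 1) / 2.
have tu : 0 <= t < u by rewrite t0/= /u; lra.
have u01 : 0 <= u < 1 by rewrite /u; lra.
pose K := C * D / (1 - t / u).
have C0 : 0 <= C.
  by have := le_trans (normc_ge0 _) (aC 0%N); rewrite expr0 mulr1.
have D0 : 0 <= D.
  by have := le_trans (normc_ge0 _) (bD 0%N); rewrite expr0 mulr1.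
have K0 : 0 <= K.
  rewrite !mulr_ge0// invr_ge0 subr_ge0 ler_pdivrMr ?mul1r;
    case/andP: tu => ? ?; lra.
apply: (@cvg0_le _ _ (geometric (K / (1 - u)) u)); last first.
  by apply: cvg_geometric; case/andP: u01 => ? ?; rewrite ger0_norm.
move=> n; pose A := \poly_(i < n) a i; pose B := \poly_(i < n) b i.
have sA : (size A <= n)%N := size_poly _ _.
have sB : (size B <= n)%N := size_poly _ _.
have trunc c E : (forall k, normc (c k) <= E * t ^+ k) ->
    forall k, normc ((\poly_(i < n) c i)`_k) <= E * t ^+ k.
  move=> cE k; rewrite coef_poly; case: ifP => // _.
  by rewrite normc_zero (le_trans (normc_ge0 _) (cE k)).
have at1 c : series c n = (\poly_(i < n) c i).[1].
  rewrite horner_poly /series/= big_mkord.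
  by apply: eq_bigr => i _; rewrite expr1n mulr1.
have -> : series a n * series b n - series (conv a b) n
    = \sum_(n <= k < n + n) (A * B)`_k.
  rewrite !at1 -hornerM (@horner_coef_wide _ (n + n)); last first.
    rewrite (leq_trans (size_polyMleq _ _))//.
    by rewrite (leq_trans (leq_pred _))// leq_add.
  rewrite -(big_mkord xpredT (fun i => (A * B)`_i * 1 ^+ i)).
  rewrite (@big_cat_nat _ _ _ n)//= ?leq_addr// addrC.
  under eq_bigr do rewrite expr1n mulr1.
  rewrite -[RHS]addr0 -addrA; congr (_ + _); apply/eqP.
  rewrite subr_eq0; apply/eqP.
  rewrite horner_poly big_mkord; apply: eq_bigr => i _; congr (_ * _).
  rewrite -conv_coef; apply: eq_conv => k ki.
    by rewrite coef_poly (leq_ltn_trans ki).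
  by rewrite coef_poly (leq_ltn_trans ki).
apply: le_trans (normc_sum _ _ _) _.
apply: (@le_trans _ _ (\sum_(n <= k < n + n) K * u ^+ k)).
  apply: ler_sum => k _; rewrite -conv_coef.
  by apply: conv_bound; [exact: tu|exact: trunc..].
rewrite -mulr_sumr.
apply: le_trans (ler_wpM2l K0 (sum_geometric_le n (n + n) u01)) _.
by rewrite mulrA mulrAC.
Qed.

(* limsup |a_n|^(1/n) <= k: the radius of convergence is at least 1 / k. *)
Definition root_bound (k : R) a := forall t, k < t -> geo_decay t a.

(** A Cauchy product needs a ratio strictly above that of its factors; the quantification over all t
    > k leaves room for it. *)
Lemma root_bound_conv k a b : 0 <= k ->
  root_bound k a -> root_bound k b -> root_bound k (conv a b).
Proof.
move=> k0 ka kb t kt; pose s := (k + t) / 2.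
have ks : k < s by rewrite /s; lra.
have st : 0 <= s < t by rewrite (le_trans k0 (ltW ks))/= /s; lra.
have [C aC] := ka _ ks; have [D bD] := kb _ ks.
by exists (C * D / (1 - s / t)) => n; apply: conv_bound st _ _.
Qed.

Lemma root_boundB k a b :
  root_bound k a -> root_bound k b -> root_bound k (fun n => a n - b n).
Proof.
move=> ka kb t kt; have [C aC] := ka _ kt; have [D bD] := kb _ kt.
exists (C + D) => n; rewrite mulrDl.
by apply: le_trans (normcB_le _ _) _; rewrite lerD.
Qed.

Lemma root_boundD k a b :
  root_bound k a -> root_bound k b -> root_bound k (fun n => a n + b n).
Proof.
move=> ka kb t kt; have [C aC] := ka _ kt; have [D bD] := kb _ kt.
exists (C + D) => n; rewrite mulrDl.
by apply: le_trans (le_normcD _ _) _; rewrite lerD.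
Qed.

Lemma root_bound_poly k P : 0 <= k -> root_bound k (nth 0 P).
Proof.
move=> k0 t kt; have t0 : 0 < t by rewrite (le_lt_trans k0).
exists (\sum_(i < size P) normc P`_i / t ^+ i) => n.
have [nP|nP] := ltnP n (size P); last first.
  rewrite nth_default// normc_zero mulr_ge0 ?exprn_ge0 ?(ltW t0)// sumr_ge0// => i _.
  by rewrite divr_ge0 ?normc_ge0// exprn_ge0// ltW.
rewrite (bigD1 (Ordinal nP))//= mulrDl divfK ?gt_eqF ?exprn_gt0// lerDl.
rewrite mulr_ge0 ?exprn_ge0 ?(ltW t0)// sumr_ge0// => i _.
by rewrite divr_ge0 ?normc_ge0// exprn_ge0// ltW.
Qed.

(** The terms of a convergent series tend to 0, hence are bounded: by 1 from some N on, by S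
    before. *)
Lemma root_bound_cvg g z : z != 0 -> cvgn (cpseries g z) ->
  root_bound (normc z)^-1 g.
Proof.
move=> z0 /(@cvg_series_cvg_0 _ _ (fun n => g n * z ^+ n)) /cvg0_normc.
move=> /cvgrPdist_lt/(_ _ ltr01)[N _ gN] t kt.
have nz0 : 0 < normc z.
  by rewrite lt_def normc_ge0 andbT; apply: contra_neq z0 => /eq0_normc.
have t0 : 0 < t by rewrite (lt_trans _ kt)// invr_gt0.
pose S := \sum_(i < N) normc (g i * z ^+ i).
have S0 : 0 <= S by apply: sumr_ge0 => i _; exact: normc_ge0.
have gS n : normc (g n * z ^+ n) <= 1 + S.
  have [Nn|nN] := leqP N n.
    have := gN n Nn; rewrite /= sub0r normrN ger0_norm ?normc_ge0// => /ltW h.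
    by rewrite (le_trans h)// lerDl.
  rewrite /S (bigD1 (Ordinal nN))//= addrCA lerDl addr_ge0// sumr_ge0// => i _.
  exact: normc_ge0.
exists (1 + S) => n; have := gS n; rewrite normcM normcX -ler_pdivlMr ?exprn_gt0//.
move=> /le_trans; apply; rewrite ler_wpM2l ?addr_ge0// -exprVn.
by rewrite lerXn2r ?nnegrE ?invr_ge0 ?(ltW nz0) ?(ltW t0) ?(ltW kt).
Qed.

Lemma geo_decay_scale t a z : geo_decay t a ->
  geo_decay (t * normc z) (fun n => a n * z ^+ n).
Proof.
move=> [C aC]; exists C => n.
by rewrite normcM normcX exprMn mulrA ler_wpM2r// exprn_ge0// normc_ge0.
Qed.

Lemma root_bound_between k x : 0 <= k -> 0 <= x -> k * x < 1 ->
  exists t : R, [/\ 0 < t, k < t & t * x < 1].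
Proof.
(* d (1 + x) is half the gap 1 - k x; the 1 + x avoids dividing by x = 0. *)
move=> k0 x0 kx; pose d := (1 - k * x) / (2 * (1 + x)).
have x1 : 0 < 1 + x by lra.
have d0 : 0 < d by rewrite divr_gt0 ?subr_gt0// mulr_gt0.
exists (k + d); split; [lra|lra|].
have dx : d * (1 + x) = (1 - k * x) / 2 by rewrite /d; field; rewrite gt_eqF.
nra.
Qed.

(** The terms a_n z^n and b_n z^n decay with a common ratio t |z| < 1, so [cvg_conv] applies to
    them. *)
Lemma cvg_cpseries_conv k a b z (x y : R[i]) : 0 <= k -> k * normc z < 1 ->
  root_bound k a -> root_bound k b ->
  cpseries a z @ \oo --> x -> cpseries b z @ \oo --> y ->
  cpseries (conv a b) z @ \oo --> x * y.
Proof.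
move=> k0 kz ka kb ax bx.
have [t [t0 /[dup] /ka /geo_decay_scale az /kb /geo_decay_scale bz tz]] :=
  root_bound_between k0 (normc_ge0 z) kz.
have tz01 : 0 <= t * normc z < 1 by rewrite mulr_ge0 ?normc_ge0 ?(ltW t0).
have h := cvg_conv tz01 (az z) (bz z).
have convE n : series (conv (fun i => a i * z ^+ i) (fun i => b i * z ^+ i)) n
    = cpseries (conv a b) z n.
  by apply: eq_bigr => i _; rewrite conv_pow.
pose d n := cpseries a z n * cpseries b z n - cpseries (conv a b) z n.
have d0 : d @ \oo --> 0 by move: h; under eq_fun do rewrite convE.
pose m n := cpseries a z n * cpseries b z n.
have mxy : m @ \oo --> x * y by exact: (cvgM ax bx).
have -> : cpseries (conv a b) z = m - d.
  by apply/funext => n; rewrite /m /d fctE subKr.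
rewrite -[x * y]subr0.
exact: (cvgB mxy d0).
Qed.

Lemma cvg_cpseries_poly P z : cpseries (nth 0 P) z @ \oo --> P.[z].
Proof.
apply: (@cvg_near_cst _ _ _ _ _ _); exists (size P) => // n /= Pn.
by rewrite /cpseries /series/= big_mkord (horner_coef_wide _ Pn).
Qed.

Lemma cvg_cpseriesD a b z (x y : R[i]) :
  cpseries a z @ \oo --> x -> cpseries b z @ \oo --> y ->
  cpseries (fun n => a n + b n) z @ \oo --> x + y.
Proof.
move=> ax bx.
have -> : cpseries (fun n => a n + b n) z = cpseries a z \+ cpseries b z.
  apply/funext => n; rewrite /cpseries /series/= -big_split/=.
  by apply: eq_bigr => i _; rewrite mulrDl.
exact: (cvgD ax bx).
Qed.

Lemma cvg_cpseriesB a b z (x y : R[i]) :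
  cpseries a z @ \oo --> x -> cpseries b z @ \oo --> y ->
  cpseries (fun n => a n - b n) z @ \oo --> x - y.
Proof.
move=> ax bx.
have -> : cpseries (fun n => a n - b n) z = cpseries a z \- cpseries b z.
  apply/funext => n; rewrite /cpseries /series/= -sumrB.
  by apply: eq_bigr => i _; rewrite mulrBl.
exact: (cvgB ax bx).
Qed.

End CauchyProduct.

(** * The identity theorem *)

Lemma identity_theorem (R : realType) (k : R) (a : nat -> R[i]) (z0 : R[i]) :
  0 <= k -> k * normc z0 < 1 -> root_bound k a ->
  (\forall z \near z0, cpseries a z @ \oo --> 0) -> forall n, a n = 0.
Proof.
move=> k0 kz ka /nbhs_ballP[e /= e0 ze].
(* The radius e lies in [R[i]]; being positive it is real. *)
have [d d0 zd] : exists2 d : R, 0 < d &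
    forall z, normc (z - z0) < d -> cpseries a z @ \oo --> 0.
  exists (complex.Re e); first by case: e e0 {ze} => x y; rewrite ltcE/= => /andP[].
  move=> z zlt; apply: ze; rewrite -ball_normE /=.
  have -> : e = (complex.Re e)%:C.
    by case: e e0 {zlt} => x y; rewrite ltcE/= => /andP[/eqP-> _].
  by rewrite -opprB normrN; move: zlt; rewrite -ltcR.
(* The scaling by t reduces to the unit disc: a_n / t^n decays with ratio s / t < 1, and the zeros t
   y have modulus at most t (|z0| + d') < 1. *)
have [t [t0 kt tz]] := root_bound_between k0 (normc_ge0 z0) kz.
pose d' := Order.min d ((1 - t * normc z0) / (2 * t)).
have d'0 : 0 < d' by rewrite lt_min d0 divr_gt0 ?subr_gt0 ?mulr_gt0.
have d'd : d' <= d by rewrite ge_min lexx.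
have td' : t * (normc z0 + d') < 1.
  have : t * d' <= (1 - t * normc z0) / 2.
    have -> : (1 - t * normc z0) / 2 = t * ((1 - t * normc z0) / (2 * t)).
      by field; rewrite gt_eqF.
    by rewrite ler_wpM2l ?(ltW t0)// ge_min lexx orbT.
  by rewrite mulrDr; lra.
(* Infinitely many zeros near z0; the denominator j + 2 > 1 keeps them strictly within d'. *)
pose y j : R[i] := z0 + (d' / j.+1.+1%:R)%:C.
have yI : injective y.
  move=> i j /addrI/complexI/(mulfI (lt0r_neq0 d'0))/invr_inj/eqP.
  by rewrite eqr_nat => /eqP[].
have yd j : normc (y j - z0) < d'.
  rewrite /y addrC addKr /= expr0n/= addr0 sqrtr_sqr gtr0_norm ?divr_gt0 ?ltr0n//.
  by rewrite ltr_pdivrMr ?ltr0n// ltr_pMr// ltr1n.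
(* By injectivity at most one y_j is 0; the indices start beyond it. *)
have [m ym] : exists m, forall j, y (j + m)%N != 0.
  have [[m ym]|ny] := pselect (exists m, y m = 0).
    exists m.+1 => j; apply/eqP; rewrite -ym => /yI; lia.
  by exists 0%N => j; apply/eqP => yj; apply: ny; exists (j + 0)%N.
have tC0 : t%:C != 0 by rewrite fmorph_eq0 gt_eqF.
pose s := (k + t) / 2.
have s01 : 0 < s / t < 1.
  rewrite divr_gt0//=; last by rewrite /s; lra.
  by rewrite ltr_pdivrMr// mul1r /s; lra.
have ks : k < s by rewrite /s; lra.
have scaled : geo_decay (s / t) (fun n => a n * (t%:C)^-1 ^+ n).
  have := geo_decay_scale (t%:C)^-1 (ka _ ks).
  rewrite normcV.
  have -> // : normc t%:C = t by rewrite /= expr0n/= addr0 sqrtr_sqr gtr0_norm.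
have nct (z : R[i]) : normc (t%:C * z) = t * normc z.
  by rewrite normcM /= expr0n/= addr0 sqrtr_sqr gtr0_norm.
have yJ : injective (fun j => t%:C * y (j + m)%N).
  by move=> i j /(mulfI tC0)/yI/addIn.
move=> n; suff /eqP : a n * (t%:C)^-1 ^+ n = 0.
  by rewrite mulf_eq0 expf_eq0 invr_eq0 (negPf tC0) andbF orbF => /eqP.
apply: (infinite_zeros s01 td' yJ _ _ _ scaled) => j.
- by rewrite mulf_neq0.
- rewrite nct ler_wpM2l ?(ltW t0)//.
  rewrite -[y _](subrK z0) addrC (le_trans (le_normcD _ _))// lerD2l.
  exact: ltW.
- have -> : cpseries (fun n => a n * (t%:C)^-1 ^+ n) (t%:C * y (j + m)%N)
      = cpseries a (y (j + m)%N).
    apply/funext => N; apply: eq_bigr => i _.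
    by rewrite -mulrA -exprMn mulKf.
  by apply: zd; rewrite (lt_le_trans (yd _)).
Qed.

(** * The differential equation modulo a power of x, and the degrees of [R], [Q], [H] *)

Section PolynomialIdentities.
Variable K : fieldType.
Implicit Types (p q v w c G L : {poly K}).

Lemma dvdXnP m L : reflect (forall k, (k < m)%N -> L`_k = 0) ('X^m %| L).
Proof.
apply: (iffP idP) => [/dvdpP[E ->] k km|L0]; first by rewrite coefMXn km.
rewrite -[L](poly_take_drop m) dvdp_addl ?dvdp_mulIr//.
suff -> : take_poly m L = 0 by [].
by apply/polyP => k; rewrite coef_take_poly coef0; case: ifP => // /L0.
Qed.

Lemma dvdXn_deriv m L : 'X^(m.+1) %| L -> 'X^m %| L^`().
Proof.
move=> /dvdXnP L0; apply/dvdXnP => k km.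
by rewrite coef_deriv L0 ?mul0rn.
Qed.

(** Only the order j of c at 0 is lost, and [size c] bounds it crudely; the cofactor u of X^j is
    coprime to X. *)
Lemma dvdXn_cancel m c L : c != 0 -> 'X^m %| c * L -> 'X^(m - size c) %| L.
Proof.
move=> c0; have [j [u]] := multiplicity_XsubC c 0; rewrite c0 subr0/= => u0 cE.
have u_neq0 : u != 0 by apply: contraNneq u0 => ->; rewrite root0.
have jc : (j <= size c)%N.
  by rewrite cE size_Mmonic ?monicXn// size_polyXn addnS/= leq_addl.
move=> ucL; have [mj|/ltnW jm] := leqP m j.
  have/eqP -> : (m - size c == 0)%N by rewrite subn_eq0 (leq_trans mj).
  by rewrite expr0 dvd1p.
apply: (@dvdp_trans _ 'X^(m - j)); first by rewrite dvdp_exp2l// leq_sub2l.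
move: ucL; rewrite cE -(subnK jm) exprD mulrAC dvdp_mul2r ?expf_neq0 ?polyX_eq0//.
rewrite addnK Gauss_dvdpr// coprimep_expl//.
by rewrite -[X in coprimep X]subr0 coprimep_sym coprimep_XsubC.
Qed.

(** With T = q^2 v^2 p, S^2 - T = N F holds exactly, so 2 T S' - T' S = S (N F)' - 2 N F S'. The
    derivative of N F costs one power of X. *)
Lemma quadratic_ode p q v w G m :
  'X^(m.+1) %| (v ^+ 2 * p - w ^+ 2) * (G * G) + 2 * q * w * G - q * q ->
  'X^m %| q * v * (polR p q v w * G^`() + polQ p q v w * G - polH p q v w).
Proof.
set N := v ^+ 2 * p - w ^+ 2; set F := (F in 'X^(m.+1) %| F) => XF.
pose S := N * G + q * w.
have XE : 'X^(m.+1) %| N * F by rewrite dvdp_mull.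
have -> : q * v * (polR p q v w * G^`() + polQ p q v w * G - polH p q v w)
    = S * (N * F)^`() - 2 * (N * F) * S^`().
  have -> : F = N * (G * G) + (q * w * G + q * w * G) - q * q by rewrite /F; ring.
  rewrite /polR /polQ /polH /S /N !expr2 !(derivB, derivD, derivM).
  ring.
apply: dvdp_sub; first by rewrite dvdp_mull// dvdXn_deriv.
by rewrite dvdp_mulr// dvdp_mull// (dvdp_trans _ XE)// dvdp_exp2l.
Qed.

(* The homogeneous equation [R y' + Q y = 0] is solved by the difference
   [y = q v s / N], [s ^+ 2 = p], of the two branches; hence
   [- Q = R * (q'/q + v'/v + p'/(2 p) - N'/N)]. *)
Lemma polQ_logderiv p q v w (N := v ^+ 2 * p - w ^+ 2) :
  polQ p q v w = 2 * p * v * q * N^`() -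
    (2 * p * v * N * q^`() + 2 * p * q * N * v^`() + v * q * N * p^`()).
Proof. by rewrite /polQ /N !expr2 !(derivB, derivM); ring. Qed.

Lemma ltn_size_mul_deriv (x y : {poly K}) :
  x * y != 0 -> (size (x * y^`())%R < size (x * y)%R)%N.
Proof.
rewrite mulf_eq0 negb_or => /andP[x0 y0].
have [->|dy0] := eqVneq y^`() 0.
  by rewrite mulr0 size_poly0 size_poly_gt0 mulf_neq0.
rewrite !size_mul//; move: x0; rewrite -size_poly_gt0.
by case: (size x) => // k _; rewrite !addSn ltn_add2l lt_size_deriv.
Qed.

(** By [polQ_logderiv] each term of Q is, up to a constant, R with one factor replaced by its
    derivative. Hence the Q_(j-1) with j <= deg R exhaust the coefficients of Q. *)
Lemma size_polQ p q v w : polR p q v w != 0 ->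
  (size (polQ p q v w) < size (polR p q v w))%N.
Proof.
move=> R0; rewrite polQ_logderiv; set N := v ^+ 2 * p - w ^+ 2.
have lt1 x y : x * y = polR p q v w ->
    (size (x * y^`())%R < size (polR p q v w))%N.
  by move=> xy; rewrite -xy; apply: ltn_size_mul_deriv; rewrite xy.
have RE : polR p q v w = 2%:R *: (v * q * N * p).
  by rewrite scaler_nat -mulr_natl /polR -/N; ring.
have two_neq0 : 2%:R != 0 :> K.
  by apply: contraNneq R0 => two0; rewrite RE two0 scale0r.
apply: (leq_ltn_trans (size_polyD _ _)); rewrite gtn_max size_polyN.
rewrite lt1 ?mulrA//=.
apply: (leq_ltn_trans (size_polyD _ _)); rewrite gtn_max.
(* The term in p' lacks the factor 2 of R, which is nonzero because R is. *)
rewrite [X in _ && X](_ : _ = true) ?andbT; last first.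
  move: R0; rewrite RE scaler_eq0 negb_or size_scale// => /andP[_].
  exact: ltn_size_mul_deriv.
apply: (leq_ltn_trans (size_polyD _ _)); rewrite gtn_max.
by apply/andP; split; apply: lt1; rewrite /polR -/N; ring.
Qed.

Lemma deriv_size1 L : (size L <= 1)%N -> L^`() = 0.
Proof. by move=> /size1_polyC ->; rewrite derivC. Qed.

(** If R is a nonzero constant, so are p, v, q and N; then w^2 = v^2 p - N is constant too, and
    every derivative in H vanishes. *)
Lemma polH_const p q v w : size (polR p q v w) = 1%N -> polH p q v w = 0.
Proof.
move=> /eqP; rewrite /polR !size_mul_eq1.
move=> /andP[/andP[/andP[/andP[_ p1] v1] q1] N1].
have w1 : (size w <= 1)%N.
  have [->|w0] := eqVneq w 0; first by rewrite size_poly0.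
  have vp1 : (size (v ^+ 2 * p)%R <= 1)%N.
    by rewrite (_ : size _ = 1%N)//; apply/eqP; rewrite expr2 !size_mul_eq1 v1 p1.
  have : (size (w ^+ 2)%R <= 1)%N.
    rewrite -[w ^+ 2](subKr (v ^+ 2 * p)) (leq_trans (size_polyD _ _))//.
    by rewrite geq_max vp1 size_polyN (eqP N1).
  rewrite expr2 size_mul//; move: w0; rewrite -size_poly_gt0.
  by case: (size w) => [|[|k]] //; rewrite addSn addnS.
rewrite /polH !deriv_size1 ?(eqP p1) ?(eqP v1)//.
by rewrite !mulr0 !subr0 mulr0.
Qed.

End PolynomialIdentities.

(** * From the expansion to the recurrence *)

Lemma cvg_disc_root_bound (R : realType) (g : nat -> R[i]) z :
  cvg_disc g z -> exists k, [/\ 0 <= k, k * normc z < 1 & root_bound k g].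
Proof.
move=> /ereal_sup_gt[_ [z1 gz1 <-]]; rewrite lte_fin => zz1.
have z10 : 0 < normc z1 := le_lt_trans (normc_ge0 _) zz1.
exists (normc z1)^-1; split; first by rewrite invr_ge0 ltW.
  by rewrite mulrC ltr_pdivrMr// mul1r.
apply: root_bound_cvg gz1; apply: contraTneq z10 => ->.
by rewrite normc_zero ltxx.
Qed.

(** On U the sum y = q / (w + v s) satisfies N y^2 + 2 q w y - q^2 = 0 because s^2 = p; the identity
    theorem at z0 carries this to the coefficients. *)
Lemma expansion_quadratic (R : realType) (p q v w : {poly R[i]})
    (g : nat -> R[i]) :
  is_expansion p q v w g -> forall n,
  conv (nth 0 (v ^+ 2 * p - w ^+ 2)%R) (conv g g) n
  + conv (nth 0 (2 * q * w)%R) g n - (q * q)`_n = 0.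
Proof.
move=> [_ [U [s [[Uo _ [z0 Uz0] Ug] [_ sE] gE]]]].
have [k [k0 kz0 kg]] := cvg_disc_root_bound (Ug _ Uz0).
have rb k' : 0 <= k' -> root_bound k' g -> root_bound k' (fun n =>
    conv (nth 0 (v ^+ 2 * p - w ^+ 2)%R) (conv g g) n
    + conv (nth 0 (2 * q * w)%R) g n - (q * q)`_n).
  move=> k'0 k'g; apply: root_boundB; last exact: root_bound_poly.
  by apply: root_boundD; do ![apply: root_bound_conv => //|exact: root_bound_poly].
apply: (identity_theorem k0 kz0 (rb _ k0 kg)).
have : \forall z \near z0, U z by apply: open_nbhs_nbhs.
apply: filterS => z Uz; have [den_neq0 gz] := gE z Uz.
(* The bound k is tied to z0; the Cauchy products at z need their own. *)
have [k' [k'0 k'z k'g]] := cvg_disc_root_bound (Ug _ Uz).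
set y := q.[z] / _ in gz.
have y0 : (v ^+ 2 * p - w ^+ 2)%R.[z] * (y * y) + (2 * q * w)%R.[z] * y
    - (q * q)%R.[z] = 0.
  by rewrite !hornerE /= -(sE z Uz) /y; field.
rewrite -[X in _ --> X]y0.
apply: cvg_cpseriesB; last exact: cvg_cpseries_poly.
have gg := cvg_cpseries_conv k'0 k'z k'g k'g gz gz.
have rbP P := root_bound_poly P k'0.
have rgg := root_bound_conv k'0 k'g k'g.
apply: cvg_cpseriesD.
  exact: (cvg_cpseries_conv k'0 k'z (rbP _) rgg (@cvg_cpseries_poly R _ z) gg).
exact: (cvg_cpseries_conv k'0 k'z (rbP _) k'g (@cvg_cpseries_poly R _ z) gz).
Qed.

Theorem theorem4 (R : realType) (p q v w : {poly R[i]}) (g : nat -> R[i])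
    (p_neq0 : p != 0) (q_neq0 : q != 0) (v_neq0 : v != 0)
    (g_exp : is_expansion p q v w g)
    (n : int)
    (n_gt : n - (deg (polR p q v w))%:Z > (deg (polH p q v w))%:Z) :
  \sum_(0 <= j < (deg (polR p q v w)).+1)
     ((n - j%:Z)%:~R * (polR p q v w)`_j
      + extz (nth 0 (polQ p q v w)) (j%:Z - 1)) * extz g (n - j%:Z) = 0.
Proof.
(* For R = 0 only j = 0 remains, and there Q_(-1) = 0. *)
have [R0|R0] := eqVneq (polR p q v w) 0.
  by rewrite R0 /deg size_poly0 big_nat1 coef0 mulr0 add0r mul0r.
set d := deg (polR p q v w) in n_gt *.
have [m mE] : exists m, n = m.+1%:Z by exists (`|n|%N.-1); lia.
have sR : size (polR p q v w) = d.+1 := polySpred R0.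
have sQ : (size (polQ p q v w) <= d)%N by rewrite -ltnS -sR size_polQ.
(* If d > 0 then m = n - 1 >= d + deg H exceeds deg H. If d = 0 then m may equal deg H, but H =
   0. *)
have Hm : (polH p q v w)`_m = 0.
  have [d0|d0] := posnP d; first by rewrite polH_const ?coef0// sR d0.
  rewrite nth_default//; move: n_gt d0; rewrite mE /deg.
  move: (size (polH p q v w)) => h; lia.
(* Cancelling q v costs at most [size (q * v)] powers of X, which leaves X^(m+2), enough to read off
   the coefficient of x^m. *)
pose M := (m.+2 + size (q * v)%R)%N.
pose G := \poly_(i < M.+1) g i.
have GE i : (i < M.+1)%N -> G`_i = g i by move=> iM; rewrite coef_poly iM.
have /quadratic_ode : 'X^(M.+1) %|
    (v ^+ 2 * p - w ^+ 2) * (G * G) + 2 * q * w * G - q * q.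
  apply/dvdXnP => i iM.
  rewrite -[RHS](expansion_quadratic g_exp i) coefB coefD; congr (_ + _ - _).
    rewrite -conv_coef; apply: eq_conv => // j ji.
    by rewrite -conv_coef; apply: eq_conv => l lj; rewrite GE//; lia.
  by rewrite -conv_coef; apply: eq_conv => // j ji; rewrite GE//; lia.
have dm : (d <= m)%N by lia.
move=> /(dvdXn_cancel (mulf_neq0 q_neq0 v_neq0)); rewrite addnK.
move=> /dvdXnP /(_ m); rewrite coefB Hm subr0 coefD => cL.
rewrite -[RHS]cL; last by rewrite ltnS leqnSn.
(* Both sums are padded with zeros to the m + 1 terms of a product coefficient. *)
have widen (F : nat -> R[i]) e : (e <= m.+1)%N ->
    (forall j, (e <= j)%N -> F j = 0) ->
    \sum_(0 <= j < e) F j = \sum_(j < m.+1) F j.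
  move=> em F0; rewrite -(big_mkord xpredT F) (@big_cat_nat _ _ _ e 0 m.+1)//=.
  rewrite [X in _ = _ + X]big_nat [X in _ = _ + X]big1 ?addr0//.
  by move=> j /andP[/F0].
under eq_bigr do rewrite mulrDl.
(* The terms (n - j) R_j g_(n-j) make up the coefficient of R G', the others that of Q G. *)
rewrite big_split/=; congr (_ + _).
  pose F j :=
    (m.+1%:Z - j%:Z)%:~R * (polR p q v w)`_j * extz g (m.+1%:Z - j%:Z).
  rewrite mE -/F (widen F)//; last first.
    by move=> j dj; rewrite /F nth_default ?mulr0 ?mul0r// sR.
  rewrite coefM; apply: eq_bigr => j _; rewrite coef_deriv /F.
  have -> : m.+1%:Z - j%:Z = (m - j).+1%:Z by have := ltn_ord j; lia.
  rewrite GE /=; last by rewrite /M; lia.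
  by rewrite -mulr_natl; ring.
(* The term j = 0 carries Q_(-1) = 0; shifting j by one turns g_(n-j) into g_(m-j). *)
rewrite big_nat_recl// mul0r add0r.
pose F j := (polQ p q v w)`_j * extz g (m%:Z - j%:Z).
transitivity (\sum_(0 <= j < d) F j).
  apply: eq_bigr => j _; rewrite mE /F.
  have -> : j.+1%:Z - 1 = j%:Z by lia.
  by have -> : m.+1%:Z - j.+1%:Z = m%:Z - j%:Z by lia.
rewrite widen//; first last.
- by move=> j dj; rewrite /F nth_default ?mul0r// (leq_trans sQ).
- exact: leqW.
rewrite coefM; apply: eq_bigr => j _; rewrite /F.
have -> : m%:Z - j%:Z = (m - j)%N by have := ltn_ord j; lia.
by rewrite GE// /M; lia.
Qed.
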